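(* Let $n \ge 0$ and let $R$ be a reduced $n$-subperfect ring. Then $R$ is a Goldie ring. Moreover, $R$ is a subdirect product of a finite number of integral domains of Krull dimension $n$, and this subdirect product is equivalent to the direct product of the components (i.e. $R$ and the direct product of these integral domains are equivalent orders in their common total quotient ring).
   Context: All rings are commutative with identity. A ring is perfect if every flat module over it is projective (equivalently, it satisfies the descending chain condition on principal ideals). $Q(A)$ denotes the total quotient ring of a ring $A$, and $A$ is subperfect if $Q(A)$ is perfect. A sequence $x_1,\ldots,x_i$ in $A$ is a regular sequence if $(x_1,\ldots,x_i)A\neq A$ and each $x_j$ is a non-zero-divisor on $A/(x_1,\ldots,x_{j-1})A$; the empty sequence is considered a regular sequence. A ring $A$ is regularly subperfect if for each regular sequence $x_1,\ldots,x_i$ in $A$ (including the empty one) the ring $A/(x_1,\ldots,x_i)A$ is subperfect. For an integer $n\ge 0$, $A$ is $n$-subperfect if $A$ is regularly subperfect and every maximal regular sequence in $A$ has length $n$. A Goldie ring is a ring that has finite uniform dimension and satisfies the ascending chain condition on annihilators of subsets. An order in a ring $Q$ is a subring whose total quotient ring is $Q$; two orders $R,R'$ in a ring $Q$ are equivalent if $qR\subseteq R'$ and $q'R'\subseteq R$ for some units $q,q'\in Q$. A ring $R$ is a subdirect product of rings $D_1,\dots,D_m$ if it is embedded as a subring of $D_1\times\cdots\times D_m$ with each projection $R\to D_j$ surjective.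
   Formalization: In ''n-subperfect'' two conditions are added: no infinite regular sequence exists, and every regular sequence that is maximal inside a maximal ideal has length n. Without them k[[t]] × k (n = 1) and k[x_0,x_1,...] localized at (x_0,x_1,...) are counterexamples. *)

(* Defs.v *)
From HB Require Import structures.
From mathcomp Require Import all_boot all_order all_algebra.
From mathcomp Require Import boolp.

Set Implicit Arguments.
Unset Strict Implicit.
Unset Printing Implicit Defensive.

Import GRing.Theory.
Import Quotient.
Local Open Scope ring_scope.
Local Open Scope quotient_scope.

(* Rings are [comPzRingType]s, so that the zero ring is allowed.  Subsets are
   boolean predicates; since [boolp] is available, every Prop-valued predicate
   [P] gives one, [fun x => `[< P x >]].  Non-zero-divisors are the elements
   satisfying the library predicate [GRing.lreg]. *)

Definition is_unit (A : comPzRingType) (u : A) : Prop := exists v, u * v = 1.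

Definition reduced (A : comPzRingType) : Prop :=
  forall (a : A) (k : nat), a ^+ k = 0 -> a = 0.

(* The library's [idealr_closed] only covers proper ideals. *)
Definition ideal (A : comPzRingType) (I : {pred A}) : Prop :=
  0 \in I /\ forall a, {in I &, forall u v, a * u + v \in I}.

Definition maximal_ideal (A : comPzRingType) (M : {pred A}) : Prop :=
  [/\ ideal M, 1 \notin M
    & forall J : {pred A}, ideal J -> 1 \notin J ->
        {subset M <= J} -> {subset J <= M}].

Definition prime_ideal (A : comNzRingType) (P : {pred A}) : Prop :=
  idealr_closed P /\ prime_idealr_closed P.

Definition prime_chain (A : comNzRingType) (k : nat) (P : nat -> {pred A}) :
    Prop :=
  (forall i, (i <= k)%N -> prime_ideal (P i)) /\
  (forall i, (i < k)%N -> {subset P i <= P i.+1} /\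
                          ~ {subset P i.+1 <= P i}).

Definition krull_dim (A : comNzRingType) (n : nat) : Prop :=
  (exists P : nat -> {pred A}, prime_chain n P) /\
  (forall k (P : nat -> {pred A}), prime_chain k P -> (k <= n)%N).

Definition bilinear_map (A : comPzRingType) (M N P : lmodType A)
    (b : M -> N -> P) : Prop :=
  (forall n, linear (b^~ n)) /\ (forall m, linear (b m)).

Definition is_tensor_product (A : comPzRingType) (M N T : lmodType A)
    (tau : M -> N -> T) : Prop :=
  bilinear_map tau /\
  forall (P : lmodType A) (b : M -> N -> P), bilinear_map b ->
    exists h : {linear T -> P}, (forall m n, h (tau m n) = b m n) /\
      forall h' : {linear T -> P}, (forall m n, h' (tau m n) = b m n) ->
        h' =1 h.

(* [g] is the map id_M (x) f : M (x) N -> M (x) N'. *)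
Definition flat (A : comPzRingType) (M : lmodType A) : Prop :=
  forall (N N' : lmodType A) (f : {linear N -> N'})
    (T T' : lmodType A) (tau : M -> N -> T) (tau' : M -> N' -> T')
    (g : {linear T -> T'}),
    is_tensor_product tau -> is_tensor_product tau' ->
    (forall m n, g (tau m n) = tau' m (f n)) ->
    injective f -> injective g.

Definition projective (A : comPzRingType) (M : lmodType A) : Prop :=
  forall (N N' : lmodType A) (p : {linear N -> N'}) (f : {linear M -> N'}),
    (forall y, exists x, p x = y) ->
    exists g : {linear M -> N}, forall m, p (g m) = f m.

Definition perfect_ring (A : comPzRingType) : Prop :=
  forall M : lmodType A, flat M -> projective M.

(* [iota] identifies [Q] with the localization of [A] at its non-zero-divisors;
   equivalently, it makes [A] an order in [Q]. *)
Definition is_total_quotient_ring (A Q : comPzRingType)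
    (iota : {rmorphism A -> Q}) : Prop :=
  [/\ injective iota,
      forall s, GRing.lreg s -> is_unit (iota s)
    & forall q, exists a s, GRing.lreg s /\ q * iota s = iota a].

Definition subperfect (A : comPzRingType) : Prop :=
  exists (Q : comPzRingType) (iota : {rmorphism A -> Q}),
    is_total_quotient_ring iota /\ perfect_ring Q.

Definition seq_ideal (A : comPzRingType) (s : seq A) : A -> bool :=
  fun x => `[< exists c : nat -> A, x = \sum_(i < size s) c i * s`_i >].

Section SeqQuot.
Variables (A : comPzRingType) (s : seq A).

Lemma seq_idealM a x : x \in seq_ideal s -> a * x \in seq_ideal s.
Proof.
move=> /asboolP[c ->]; apply/asboolP; exists (fun i => a * c i).
by rewrite mulr_sumr; apply: eq_bigr => i _; rewrite mulrA.
Qed.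

Lemma seq_ideal_zmod_closed : zmod_closed (seq_ideal s).
Proof.
split=> [|x y /asboolP[c ->] /asboolP[d ->]]; apply/asboolP.
  by exists (fun=> 0); rewrite big1 // => i _; rewrite mul0r.
exists (fun i => c i - d i); rewrite -sumrB.
by apply: eq_bigr => i _; rewrite mulrBl.
Qed.

HB.instance Definition _ :=
  GRing.isZmodClosed.Build A (seq_ideal s) seq_ideal_zmod_closed.

(* The library puts a ring structure on quotients by proper ideals of nonzero
   rings only; the construction below is the same one. *)
Definition seq_quot : Type :=
  {quot (GRing.ZmodClosed.clone A (seq_ideal s) _)}.

HB.instance Definition _ := GRing.Zmodule.on seq_quot.
HB.instance Definition _ := EqQuotient.on seq_quot.

Definition seq_proj (x : A) : seq_quot := \pi_seq_quot x.
Definition seq_quot_one : seq_quot := seq_proj 1.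
Definition seq_quot_mul (x y : seq_quot) : seq_quot :=
  seq_proj (repr x * repr y).

Lemma seq_proj_surj (x : seq_quot) : exists a, x = seq_proj a.
Proof. by exists (repr x); rewrite /seq_proj reprK. Qed.

Lemma seq_proj_eq (x y : A) :
  (seq_proj x == seq_proj y) = (x - y \in seq_ideal s).
Proof. by rewrite /seq_proj idealrBE. Qed.

Fact seq_proj_is_zmod_morphism : zmod_morphism seq_proj.
Proof.
exact: (pi_is_zmod_morphism (quot (GRing.ZmodClosed.clone A (seq_ideal s) _))).
Qed.

HB.instance Definition _ := GRing.isZmodMorphism.Build A seq_quot seq_proj
  seq_proj_is_zmod_morphism.

Fact seq_projM (x y : A) :
  seq_proj (x * y) = seq_quot_mul (seq_proj x) (seq_proj y).
Proof.
have repr_proj (z : A) : z - repr (seq_proj z) \in seq_ideal s.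
  by rewrite -seq_proj_eq /seq_proj reprK.
apply/eqP; rewrite seq_proj_eq.
set x' := repr (seq_proj x); set y' := repr (seq_proj y).
have -> : x * y - x' * y' = y * (x - x') + x' * (y - y').
  by rewrite !mulrBr [y * x]mulrC [y * x']mulrC addrA subrK.
by apply: rpredD; apply: seq_idealM; apply: repr_proj.
Qed.

Fact seq_quot_mulA : associative seq_quot_mul.
Proof.
move=> x y z; have [a ->] := seq_proj_surj x.
have [b ->] := seq_proj_surj y; have [c ->] := seq_proj_surj z.
by rewrite -(seq_projM b) -(seq_projM a b) -!seq_projM mulrA.
Qed.

Fact seq_quot_mulC : commutative seq_quot_mul.
Proof. by move=> x y; rewrite /seq_quot_mul mulrC. Qed.

Fact seq_quot_mul1 : left_id seq_quot_one seq_quot_mul.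
Proof.
move=> x; have [a ->] := seq_proj_surj x.
by rewrite -(seq_projM 1 a) mul1r.
Qed.

Fact seq_quot_mulDl : left_distributive seq_quot_mul +%R.
Proof.
move=> x y z; have [a ->] := seq_proj_surj x.
have [b ->] := seq_proj_surj y; have [c ->] := seq_proj_surj z.
by rewrite -raddfD -(seq_projM a c) -(seq_projM b c) -seq_projM -raddfD mulrDl.
Qed.

HB.instance Definition _ := GRing.Zmodule_isComPzRing.Build seq_quot
  seq_quot_mulA seq_quot_mulC seq_quot_mul1 seq_quot_mulDl.

Fact seq_proj_is_monoid_morphism : monoid_morphism seq_proj.
Proof. by split=> // x y; apply: seq_projM. Qed.

HB.instance Definition _ := GRing.isMonoidMorphism.Build A seq_quot seq_proj
  seq_proj_is_monoid_morphism.

End SeqQuot.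

Definition regular_seq (A : comPzRingType) (s : seq A) : Prop :=
  s = [::] \/
  ((exists a, a \notin seq_ideal s) /\
   forall j, (j < size s)%N ->
     GRing.lreg (seq_proj (take j s) s`_j)).

Definition maximal_regular_seq_in (A : comPzRingType) (I : {pred A})
    (s : seq A) : Prop :=
  [/\ regular_seq s, {subset s <= I}
    & forall x, x \in I -> ~ regular_seq (rcons s x)].

Definition regularly_subperfect (A : comPzRingType) : Prop :=
  forall s : seq A, regular_seq s -> subperfect (seq_quot s).

(* "Every maximal regular sequence in A has length n" is meant in the sense
   usual for the Cohen-Macaulay property, where it includes two things that the
   second conjunct alone does not say.
   - A regular sequence cannot be prolonged for ever.  Otherwise the
     localization of k[x_0, x_1, ...] at (x_0, x_1, ...), which has no maximal
     regular sequence at all, would be n-subperfect for every n.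
   - Maximality is also tested inside each maximal ideal, i.e. every maximal
     ideal has grade n.  Otherwise k[[t]] * k would be 1-subperfect: its only
     regular sequences are the empty one and the (t^e u, v) with e > 0 and
     u, v units, although it has a maximal ideal consisting of zero-divisors
     and a component of Krull dimension 0. *)
Definition n_subperfect (n : nat) (A : comPzRingType) : Prop :=
  [/\ regularly_subperfect A,
      forall s : seq A, maximal_regular_seq_in predT s -> size s = n,
      ~ exists x : nat -> A, forall k, regular_seq (mkseq x k)
    & forall M : {pred A}, maximal_ideal M ->
        forall s : seq A, maximal_regular_seq_in M s -> size s = n].

Definition nonzero_ideal (A : comPzRingType) (I : {pred A}) : Prop :=
  ideal I /\ exists2 x, x \in I & x != 0.

Definition uniform_ideal (A : comPzRingType) (U : {pred A}) : Prop :=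
  nonzero_ideal U /\
  forall J K : {pred A}, nonzero_ideal J -> nonzero_ideal K ->
    {subset J <= U} -> {subset K <= U} ->
    exists x, [/\ x \in J, x \in K & x != 0].

(* The sum of the [U i] is direct, and it is essential: it meets every nonzero
   ideal. *)
Definition uniform_dim (A : comPzRingType) (d : nat) : Prop :=
  exists U : 'I_d -> {pred A},
    [/\ forall i, uniform_ideal (U i),
        forall x : 'I_d -> A, (forall i, x i \in U i) ->
          \sum_i x i = 0 -> forall i, x i = 0
      & forall J : {pred A}, nonzero_ideal J ->
          exists x : 'I_d -> A, [/\ forall i, x i \in U i,
            \sum_i x i \in J & \sum_i x i != 0]].

Definition annihilator (A : comPzRingType) (S : {pred A}) : {pred A} :=
  fun a => `[< forall x, x \in S -> a * x = 0 >].

Definition acc_annihilators (A : comPzRingType) : Prop :=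
  forall S : nat -> {pred A},
    (forall k, {subset annihilator (S k) <= annihilator (S k.+1)}) ->
    exists N, forall k, (N <= k)%N -> annihilator (S k) =i annihilator (S N).

Definition goldie (A : comPzRingType) : Prop :=
  (exists d, uniform_dim A d) /\ acc_annihilators A.

Definition prod_ring (m : nat) (D : 'I_m -> comPzRingType) : Type :=
  {dffun forall j, D j}.

Section ProdRing.
Variables (m : nat) (D : 'I_m -> comPzRingType).
Implicit Types f g h : prod_ring D.

HB.instance Definition _ := Choice.on (prod_ring D).

Definition prod_zero : prod_ring D := [ffun j => 0 : D j].
Definition prod_one : prod_ring D := [ffun j => 1 : D j].
Definition prod_opp f : prod_ring D := [ffun j => - f j : D j].
Definition prod_add f g : prod_ring D := [ffun j => f j + g j : D j].
Definition prod_mul f g : prod_ring D := [ffun j => f j * g j : D j].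

Fact prod_addA : associative prod_add.
Proof. by move=> f g h; apply/ffunP => j; rewrite !ffunE addrA. Qed.
Fact prod_addC : commutative prod_add.
Proof. by move=> f g; apply/ffunP => j; rewrite !ffunE addrC. Qed.
Fact prod_add0 : left_id prod_zero prod_add.
Proof. by move=> f; apply/ffunP => j; rewrite !ffunE add0r. Qed.
Fact prod_addN : left_inverse prod_zero prod_opp prod_add.
Proof. by move=> f; apply/ffunP => j; rewrite !ffunE addNr. Qed.

HB.instance Definition _ := GRing.isZmodule.Build (prod_ring D)
  prod_addA prod_addC prod_add0 prod_addN.

Fact prod_mulA : associative prod_mul.
Proof. by move=> f g h; apply/ffunP => j; rewrite !ffunE mulrA. Qed.
Fact prod_mulC : commutative prod_mul.
Proof. by move=> f g; apply/ffunP => j; rewrite !ffunE mulrC. Qed.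
Fact prod_mul1 : left_id prod_one prod_mul.
Proof. by move=> f; apply/ffunP => j; rewrite !ffunE mul1r. Qed.
Fact prod_mulDl : left_distributive prod_mul +%R.
Proof. by move=> f g h; apply/ffunP => j; rewrite !ffunE mulrDl. Qed.

HB.instance Definition _ := GRing.Zmodule_isComPzRing.Build (prod_ring D)
  prod_mulA prod_mulC prod_mul1 prod_mulDl.

End ProdRing.

Definition is_subdirect_product (A : comPzRingType) (m : nat)
    (D : 'I_m -> comPzRingType) (f : {rmorphism A -> prod_ring D}) : Prop :=
  injective f /\ forall (j : 'I_m) (y : D j), exists a, f a j = y.

Definition equivalent_orders (A A' Q : comPzRingType)
    (iota : {rmorphism A -> Q}) (iota' : {rmorphism A' -> Q}) : Prop :=
  [/\ is_total_quotient_ring iota,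
      is_total_quotient_ring iota',
      exists q, is_unit q /\ forall a, exists a', q * iota a = iota' a'
    & exists q', is_unit q' /\ forall a', exists a, q' * iota' a' = iota a].

(* Main.v *)
Require Import Defs.
From HB Require Import structures.
From mathcomp Require Import all_boot all_order all_algebra.
From mathcomp Require Import boolp classical_sets functions.
From mathcomp Require Import ring.

Set Implicit Arguments.
Unset Strict Implicit.
Unset Printing Implicit Defensive.

Import GRing.Theory.
Local Open Scope ring_scope.
Local Open Scope quotient_scope.

(** Perfectness enters once, through Bass's argument ([perfect_chain]): for a
    sequence a_0, a_1, ... the colimit of A -a_0-> A -a_1-> ... is flat, hence
    projective, and a section of its free presentation forces the descending
    chain of principal ideals (a_0 ... a_k) to become stationary.  Applied to
    elements outside a prime P of a perfect ring Q, the chain condition yields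
    an idempotent e outside P such that e P is nil ([perfect_local_idempotent]):
    Q is a product of local rings with nil maximal ideals, seen one factor at a
    time.  Clearing denominators, if A is subperfect and P is a prime made of
    zero-divisors, there are a non-zero-divisor t and y outside P with y^2 = t
    y, every element of P having a power that kills y; here y / t is the
    idempotent e ([subperfect_local_idempotent]).  This is used modulo every
    regular sequence s ([zero_divisor_prime_local]), and everything else is
    elementary.

    Dimension at most n.  If P < P' are primes containing s, then P' contains an
    element that is regular modulo s: otherwise some y outside P' is killed by a
    power of each p in P', modulo s, so that p lies in P.  A chain of primes of
    length k therefore contains in its top a regular sequence of length k
    ([regular_seq_in_chain]), and regular sequences have length at most n
    ([prime_chain_length]).

    Dimension at least n.  Starting from a prime P made of zero-divisors modulo
    s, [zero_divisor_prime_step] prolongs s by some x and finds a strictly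
    larger prime made of zero-divisors modulo (s, x).  It is enough that some y
    outside (s, x) be killed modulo s by a power of each element of P.  If the
    idempotent y / t is not in A / (s), its denominator t serves as x, since y
    is not a multiple of t.  If it is, then any x that is regular modulo s in a
    maximal ideal above P will do, and there is one as long as s is shorter than
    the grade n. Iterating gives a chain of length n from any such P
    ([zero_divisor_prime_chain]).

    Structure.  When R is reduced, a prime P made of zero-divisors is the
    annihilator of y.  These elements y generate an ideal that lies in no such
    prime, hence contains a non-zero-divisor; so finitely many of them have
    joint annihilator 0, and after discarding repetitions they are pairwise
    orthogonal ([reduced_subperfect_atoms]).  With y_1, ..., y_m such a family,
    R embeds in the product of the domains D_i = R / ann(y_i), the element c =
    y_1 + ... + y_m is a non-zero-divisor that multiplies the product of the D_i
    into R ([conductor_product]), and the common total quotient ring is the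
    product of the fraction fields of the D_i ([atoms_equivalent_orders]).  The
    ideals y_i R are uniform with essential direct sum, and an annihilator is
    determined by the y_i that it contains, which gives the Goldie property
    ([atoms_goldie]). *)

(** * Quotients of modules *)

Section QuotientModule.
Variables (A : comPzRingType) (V : lmodType A).

Record submodule := Submodule {
  submodule_mem :> V -> Prop;
  submodule0 : submodule_mem 0;
  submoduleP : forall a u v, submodule_mem u -> submodule_mem v ->
    submodule_mem (a *: u + v) }.

Variable S : submodule.

Definition submodule_pred : V -> bool := fun v => `[< S v >].

Lemma submodule_scale a v : v \in submodule_pred -> a *: v \in submodule_pred.
Proof.
move=> /asboolP Sv; apply/asboolP.
by rewrite -[_ *: _]addr0; apply: submoduleP => //; apply: submodule0.
Qed.

Lemma submodule_zmod_closed : zmod_closed submodule_pred.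
Proof.
split=> [|u v /asboolP Su /asboolP Sv]; apply/asboolP; first exact: submodule0.
by rewrite addrC -scaleN1r; apply: submoduleP.
Qed.

HB.instance Definition _ :=
  GRing.isZmodClosed.Build V submodule_pred submodule_zmod_closed.

Definition quot_mod : Type :=
  Quotient.quot (GRing.ZmodClosed.clone V submodule_pred _).

HB.instance Definition _ := GRing.Zmodule.on quot_mod.
HB.instance Definition _ := EqQuotient.on quot_mod.

Definition mod_proj (v : V) : quot_mod := \pi_quot_mod v.

Lemma mod_projK (x : quot_mod) : mod_proj (repr x) = x.
Proof. by rewrite /mod_proj reprK. Qed.

Lemma mod_proj_eq (u v : V) :
  (mod_proj u == mod_proj v) = (u - v \in submodule_pred).
Proof. by rewrite /mod_proj Quotient.idealrBE. Qed.

Fact mod_proj_zmod_morphism : zmod_morphism mod_proj.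
Proof.
exact: (pi_is_zmod_morphism
  (Quotient.quot (GRing.ZmodClosed.clone V submodule_pred _))).
Qed.

HB.instance Definition _ :=
  GRing.isZmodMorphism.Build V quot_mod mod_proj mod_proj_zmod_morphism.

Definition quot_mod_scale (a : A) (x : quot_mod) : quot_mod :=
  mod_proj (a *: repr x).

Fact mod_projZ a v : mod_proj (a *: v) = quot_mod_scale a (mod_proj v).
Proof.
apply/eqP; rewrite mod_proj_eq -scalerBr submodule_scale//.
by rewrite -mod_proj_eq mod_projK.
Qed.

Fact quot_mod_scaleA a b x :
  quot_mod_scale a (quot_mod_scale b x) = quot_mod_scale (a * b) x.
Proof. by rewrite -mod_projZ scalerA. Qed.

Fact quot_mod_scale1 : left_id 1 quot_mod_scale.
Proof. by move=> x; rewrite /quot_mod_scale scale1r mod_projK. Qed.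

Fact quot_mod_scaleDr : right_distributive quot_mod_scale +%R.
Proof.
move=> a x y; rewrite -[x]mod_projK -[y]mod_projK -raddfD -!mod_projZ.
by rewrite scalerDr raddfD.
Qed.

Fact quot_mod_scaleDl x : {morph quot_mod_scale^~ x : a b / a + b}.
Proof. by move=> a b; rewrite /quot_mod_scale scalerDl raddfD. Qed.

HB.instance Definition _ := GRing.Zmodule_isLmodule.Build A quot_mod
  quot_mod_scaleA quot_mod_scale1 quot_mod_scaleDr quot_mod_scaleDl.

Fact mod_proj_scalable : scalable mod_proj.
Proof. exact: mod_projZ. Qed.

HB.instance Definition _ :=
  GRing.isScalable.Build A V quot_mod *:%R mod_proj mod_proj_scalable.

(** The interface through which quotients are used below: only surjectivity and
    the kernel of the projection matter. *)
Lemma quotient_module_exists :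
  exists (W : lmodType A) (p : {linear V -> W}),
    (forall w, exists v, p v = w) /\ forall v, p v = 0 <-> S v.
Proof.
exists quot_mod, mod_proj; split=> [w|v].
  by exists (repr w); apply: mod_projK.
rewrite -(raddf0 mod_proj); split=> [/eqP|Sv].
  by rewrite mod_proj_eq subr0 => /asboolP.
by apply/eqP; rewrite mod_proj_eq subr0; apply/asboolP.
Qed.

End QuotientModule.

(** * Perfect rings: chains of principal ideals terminate *)

Lemma bilinear0r (A : comPzRingType) (M N P : lmodType A) (b : M -> N -> P) m :
  bilinear_map b -> b m 0 = 0.
Proof.
move=> [_ bl]; have := bl m (-1) 0 0.
by rewrite !(scaleN1r, addNr).
Qed.

Lemma bilinear_scale_swap (A : comPzRingType) (M N P : lmodType A)
    (b : M -> N -> P) a m n :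
  bilinear_map b -> b (a *: m) n = b m (a *: n).
Proof.
move=> bb; have [bl br] := bb.
have b0 : b 0 n = 0.
  by have := bl n (-1) 0 0; rewrite !(scaleN1r, addNr).
rewrite -[a *: m]addr0 -[a *: n]addr0 bl br bilinear0r// b0.
by [].
Qed.

Section Telescope.
Variables (A : comNzRingType) (a : nat -> A).

(** The value at stage k, in the colimit of A -a_0-> A -a_1-> ..., of the
    element whose coordinate c_j is placed at stage j.  Polynomials serve as the
    free module on the stages: 'X^j is the generator of stage j. *)
Definition telescope_eval (k : nat) (c : {poly A}) : A :=
  \sum_(j < k) c`_j * \prod_(j <= l < k) a l.

Lemma telescope_evalD k u c d :
  telescope_eval k (u *: c + d) = u * telescope_eval k c + telescope_eval k d.
Proof.
rewrite mulr_sumr -big_split; apply: eq_bigr => j _ /=.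
by rewrite coefD coefZ mulrDl mulrA.
Qed.

Lemma telescope_evalB k c d :
  telescope_eval k (c - d) = telescope_eval k c - telescope_eval k d.
Proof. by rewrite addrC -scaleN1r telescope_evalD mulN1r addrC. Qed.

Lemma telescope_evalX i k : (i < k)%N ->
  telescope_eval k 'X^i = \prod_(i <= l < k) a l.
Proof.
move=> ik; rewrite /telescope_eval (bigD1 (Ordinal ik))//=.
rewrite coefXn eqxx mul1r [X in _ + X]big1 ?addr0// => j ji.
by rewrite coefXn -[_ == _]/(j == Ordinal ik) (negPf ji) mul0r.
Qed.

Lemma telescope_eval_stable (c : {poly A}) i k :
  (size c <= i)%N -> (i <= k)%N ->
  telescope_eval k c = telescope_eval i c * \prod_(i <= l < k) a l.
Proof.
move=> ci; elim: k => [|k IH].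
  by rewrite leqn0 => /eqP->; rewrite big_geq// mulr1.
rewrite leq_eqVlt => /predU1P[<-|]; first by rewrite big_geq// mulr1.
rewrite ltnS => ik; rewrite big_nat_recr//= mulrA -IH// /telescope_eval.
rewrite big_ord_recr/= nth_default ?(leq_trans ci)// mul0r addr0 mulr_suml.
by apply: eq_bigr => j _; rewrite (big_nat_recr k)//= ?mulrA // ltnW.
Qed.

(** The relations that present the colimit: an element of the free module
    vanishes in it exactly when it vanishes at all late stages. *)
Definition telescope_null (c : {poly A}) : Prop :=
  exists K, forall k, (K <= k)%N -> telescope_eval k c = 0.

Lemma telescope_null0 : telescope_null 0.
Proof.
exists 0%N => k _; rewrite /telescope_eval big1// => j _.
by rewrite coef0 mul0r.
Qed.

Lemma telescope_nullD u c d :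
  telescope_null c -> telescope_null d -> telescope_null (u *: c + d).
Proof.
move=> [K cK] [L dL]; exists (maxn K L) => k; rewrite geq_max => /andP[Kk Lk].
by rewrite telescope_evalD cK// dL// mulr0 addr0.
Qed.

Definition telescope_relations : submodule {poly A} :=
  Submodule telescope_null0 telescope_nullD.

Section Colimit.
Variables (B : lmodType A) (p : {linear {poly A} -> B}).
Hypothesis p_surj : forall b, exists c, p c = b.
Hypothesis p_ker : forall c, p c = 0 <-> telescope_null c.

Let x i : B := p 'X^i.

(** Every element of the colimit comes from a single stage. *)
Lemma telescope_normal (c : {poly A}) k :
  (size c <= k)%N -> p c = telescope_eval k c *: x k.
Proof.
move=> ck; apply/eqP; rewrite -subr_eq0 -linearZ/= -raddfB; apply/eqP/p_ker.
exists k.+1 => l kl; rewrite telescope_evalB.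
rewrite -[_ *: 'X^k]addr0 telescope_evalD telescope_evalX//.
have -> : telescope_eval l (0 : {poly A}) = 0.
  by rewrite /telescope_eval big1// => j _; rewrite coef0 mul0r.
by rewrite addr0 (telescope_eval_stable ck (ltnW kl)) subrr.
Qed.

Lemma telescope_step i k : (i <= k)%N -> x i = (\prod_(i <= l < k) a l) *: x k.
Proof.
rewrite leq_eqVlt => /predU1P[<-|ik]; first by rewrite big_geq// scale1r.
by rewrite /x (@telescope_normal 'X^i k) ?size_polyXn// telescope_evalX.
Qed.

Section Tensor.
Variables (N T : lmodType A) (tau : B -> N -> T).
Hypothesis tauT : is_tensor_product tau.

(** The elements of the form on the right make up a submodule, because two
    stages can be moved to a later common one.  The projection onto the quotient
    by it vanishes on all the tensors, as the zero map does; so it is zero by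
    the uniqueness part of the universal property. *)
Lemma telescope_tensor_elements t : exists i n, t = tau (x i) n.
Proof.
have [tau_bil tau_univ] := tauT.
pose S t := exists i n, t = tau (x i) n.
have S0 : S 0 by exists 0%N, 0; rewrite bilinear0r.
have SD u t1 t2 : S t1 -> S t2 -> S (u *: t1 + t2).
  move=> [i [n ->]] [j [m ->]]; exists (maxn i j).
  rewrite (telescope_step (leq_maxl i j)) (telescope_step (leq_maxr i j)).
  rewrite !(bilinear_scale_swap _ _ _ tau_bil) -tau_bil.2.
  by eexists.
have [W [q [q_surj q_ker]]] := quotient_module_exists (Submodule S0 SD).
have [|h [_ h_uniq]] := tau_univ W (fun _ _ => 0).
  by split=> [n|b] u v w; rewrite scaler0 addr0.
apply/q_ker; rewrite -/(S t) (h_uniq q).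
  by rewrite -(h_uniq \0).
move=> b n; apply/q_ker; have [c <-] := p_surj b.
exists (size c), (telescope_eval (size c) c *: n).
by rewrite (telescope_normal (leqnn _)) (bilinear_scale_swap _ _ _ tau_bil).
Qed.

(** A bilinear map detects the vanishing: send b, n to the sequence of the b_k
    n, with b_k the value of b at stage k, modulo the sequences that vanish
    eventually.  This quotient of the sequence space contains the colimit of
    copies of N, and is easier to construct. *)
Lemma telescope_tensor_eq0 i n :
  tau (x i) n = 0 <-> exists2 k, (i <= k)%N & (\prod_(i <= l < k) a l) *: n = 0.
Proof.
have [tau_bil tau_univ] := tauT; split=> [t0|[k ik n0]]; last first.
  by rewrite (telescope_step ik) (bilinear_scale_swap _ _ _ tau_bil) n0
    bilinear0r.
pose S (f : nat -> N) := exists K, forall k, (K <= k)%N -> f k = 0.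
have S0 : S 0 by exists 0%N.
have SD u f g : S f -> S g -> S (u *: f + g).
  move=> [K fK] [L gL]; exists (maxn K L) => k.
  rewrite geq_max => /andP[Kk Lk].
  by rewrite -[LHS]/(u *: f k + g k) fK// gL// scaler0 addr0.
have [W [q [q_surj q_ker]]] := quotient_module_exists (Submodule S0 SD).
have [s sK] := choice p_surj.
pose b (y : B) (m : N) : W := q (fun k => telescope_eval k (s y) *: m).
have q_eq f g : S (f - g) -> q f = q g.
  by move=> /q_ker/eqP; rewrite raddfB subr_eq0 => /eqP.
have s_eq y z : p y = p z ->
    exists K, forall k, (K <= k)%N -> telescope_eval k y = telescope_eval k z.
  move/eqP; rewrite -subr_eq0 -raddfB => /eqP/p_ker[K yzK].
  by exists K => k /yzK/eqP; rewrite telescope_evalB subr_eq0 => /eqP.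
have b_bil : bilinear_map b.
  split=> [m u y z|y u m m']; rewrite -linearP; apply: q_eq.
    have [|K sE] := @s_eq (s (u *: y + z)) (u *: s y + s z).
      by rewrite linearP !sK.
    exists K => k /sE skE; rewrite -[LHS]/(_ - (u *: _ + _)) skE.
    by rewrite telescope_evalD scalerDl scalerA subrr.
  exists 0%N => k _; rewrite -[LHS]/(_ - (u *: _ + _)).
  by rewrite scalerDr !scalerA [u * _]mulrC subrr.
have [h [hE _]] := tau_univ W b b_bil.
have /q_ker[K nK] : b (x i) n = 0 by rewrite -hE t0 raddf0.
have [|L sE] := @s_eq (s (x i)) 'X^i; first by rewrite sK.
exists (maxn i.+1 (maxn K L)); first by rewrite ltnW// leq_maxl.
rewrite -telescope_evalX ?leq_maxl// -sE ?nK//.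
  by rewrite (leq_trans (leq_maxl K L))// leq_maxr.
by rewrite (leq_trans (leq_maxr K L))// leq_maxr.
Qed.

End Tensor.

(** The colimit is a filtered colimit of free modules: a tensor comes from one
    stage, where an injective map does not make it vanish at any later stage. *)
Lemma telescope_flat : flat B.
Proof.
move=> N N' f T T' tau tau' g tauT tau'T gE f_inj; apply: raddf_inj => t.
have [i [n ->]] := telescope_tensor_elements tauT t.
move=> /(etrans (esym (gE _ _)))/(telescope_tensor_eq0 tau'T)[k ik fn0].
apply/(telescope_tensor_eq0 tauT); exists k => //.
by apply: f_inj; rewrite linearZ/= fn0 raddf0.
Qed.

(** Let s be a section of the free presentation p, and let c be the image by s
    of the generator of stage 0.  As this generator is a_0 ... a_{K-1} times
    that of stage K, all the coordinates of c are multiples of a_0 ... a_{K-1},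
    for every K.  But c and the generator agree in the colimit, hence at some
    stage k, where the value is a_0 ... a_{k-1}. *)
Lemma telescope_projective_chain : projective B ->
  exists k, forall K, exists z,
    \prod_(0 <= l < k) a l = (\prod_(0 <= l < K) a l) * z.
Proof.
move=> B_proj; have [s sK] := B_proj _ _ p idfun p_surj.
pose c := s (x 0%N).
have cE K : c = (\prod_(0 <= l < K) a l) *: s (x K).
  by rewrite /c (telescope_step (leq0n K)) linearZ.
have /eqP : p (c - 'X^0) = 0 by rewrite raddfB/= [p c]sK subrr.
move=> /eqP/p_ker[k ck]; exists k.+1 => K.
have := ck _ (leqnSn k).
rewrite telescope_evalB telescope_evalX// => /eqP.
rewrite subr_eq0 => /eqP <-; rewrite (cE K).
exists (telescope_eval k.+1 (s (x K))).
rewrite mulr_sumr; apply: eq_bigr => j _.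
by rewrite coefZ mulrA.
Qed.

End Colimit.

Lemma perfect_chain_nz : perfect_ring A ->
  exists k, forall K, exists z,
    \prod_(0 <= l < k) a l = (\prod_(0 <= l < K) a l) * z.
Proof.
move=> A_perfect.
have [B [p [p_surj p_ker]]] := quotient_module_exists telescope_relations.
exact: (telescope_projective_chain p_surj p_ker
  (A_perfect B (telescope_flat p_surj p_ker))).
Qed.

End Telescope.

(** The zero ring is set apart because polynomials need a nonzero ring of
    coefficients. *)
Lemma perfect_chain (A : comPzRingType) (a : nat -> A) : perfect_ring A ->
  exists k, forall K, exists z,
    \prod_(0 <= l < k) a l = (\prod_(0 <= l < K) a l) * z.
Proof.
have [A0 _|A_nz] := eqVneq (1 : A) 0.
  by exists 0%N => K; exists 0; rewrite mulr0 big_geq.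
pose A' : comNzRingType :=
  HB.pack (A : Type) A (GRing.PzSemiRing_isNonZero.Build A A_nz).
exact: (@perfect_chain_nz A' a).
Qed.

(** * Prime ideals and idempotents of perfect rings *)

Section Ideals.
Variable A : comPzRingType.
Implicit Types (I J K P : {pred A}) (a b x : A).

Lemma ideal_mull I a x : ideal I -> x \in I -> a * x \in I.
Proof. by move=> [I0 ID] xI; rewrite -[_ * _]addr0 ID. Qed.

Lemma ideal_mulr I a x : ideal I -> x \in I -> x * a \in I.
Proof. by rewrite mulrC; apply: ideal_mull. Qed.

Lemma ideal_add I a b : ideal I -> a \in I -> b \in I -> a + b \in I.
Proof. by move=> [I0 ID] aI bI; rewrite -[a]mul1r ID. Qed.

Lemma ideal_sub I a b : ideal I -> a \in I -> b \in I -> a - b \in I.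
Proof.
by move=> II aI bI; rewrite ideal_add// -mulN1r ideal_mull.
Qed.

Lemma ideal_sum I (T : Type) (r : seq T) (p : pred T) (F : T -> A) :
  ideal I -> (forall i, p i -> F i \in I) -> \sum_(i <- r | p i) F i \in I.
Proof.
move=> II FI; apply: (big_ind (fun x => x \in I)) => //; first by case: II.
by move=> a b; apply: ideal_add.
Qed.

Definition adjoin I x : {pred A} :=
  fun z => `[< exists u c, u \in I /\ z = u + c * x >].

Lemma adjoin_ideal I x : ideal I -> ideal (adjoin I x).
Proof.
move=> II; split.
  by apply/asboolP; exists 0, 0; rewrite mul0r addr0; case: II.
move=> a _ _ /asboolP[u [c [uI ->]]] /asboolP[v [d [vI ->]]]; apply/asboolP.
exists (a * u + v), (a * c + d); split; first by case: II => _; apply.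
by ring.
Qed.

Lemma adjoin_sub I x : {subset I <= adjoin I x}.
Proof. by move=> u uI; apply/asboolP; exists u, 0; rewrite mul0r addr0. Qed.

Lemma adjoin_mem I x : ideal I -> x \in adjoin I x.
Proof.
by move=> II; apply/asboolP; exists 0, 1; rewrite mul1r add0r; case: II.
Qed.

(** Zorn's lemma.  With S the singleton of 1 this produces maximal ideals, with
    S multiplicative it produces primes. *)
Lemma maximal_disjoint_ideal J (S : A -> Prop) :
  ideal J -> (forall x, x \in J -> ~ S x) ->
  exists P, [/\ ideal P, {subset J <= P}, forall x, x \in P -> ~ S x
    & forall K, ideal K -> {subset P <= K} -> (forall x, x \in K -> ~ S x) ->
        {subset K <= P}].
Proof.
move=> JI JS.
(* With {pred A} in place of A -> bool the universe of this type would be too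
   high for Zorn's lemma. *)
pose T := {K : A -> bool |
  [/\ ideal K, {subset J <= K} & forall x, x \in K -> ~ S x]}.
pose le : rel T := fun (K L : T) => `[< {subset sval K <= sval L} >].
pose tJ : T := exist _ (J : A -> bool) (And3 JI (fun=> id) JS).
have [|||[P [PI JP PS]] Pmax] := @ZL_preorder T tJ le.
- by move=> K; apply/asboolP.
- move=> l k m /asboolP KL /asboolP LM; apply/asboolP => x /KL; exact: LM.
- move=> C Ctot; have [[k0 Ck0]|C0] := pselect (exists k, C k); last first.
    by exists tJ => k Ck; case: C0; exists k.
  pose U : A -> bool := fun x => `[< exists2 k : T, C k & x \in sval k >].
  have UT : [/\ ideal U, {subset J <= U} & forall x, x \in U -> ~ S x].
    split=> [|x xJ|x /asboolP[k _ xk]].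
    - split=> [|a u v /asboolP[k Ck uk] /asboolP[l Cl vl]]; apply/asboolP.
        by exists k0 => //; case: (svalP k0) => -[].
      have [/asboolP kl|/asboolP lk] := Ctot _ _ Ck Cl.
        exists l => //; case: (svalP l) => -[_ lD] _ _; apply: lD => //.
        exact: kl.
      exists k => //; case: (svalP k) => -[_ kD] _ _; apply: kD => //.
      exact: lk.
    - by apply/asboolP; exists k0 => //; case: (svalP k0) => _ + _; apply.
    - by case: (svalP k) => _ _; apply.
  exists (exist _ U UT) => k Ck; apply/asboolP => x xk.
  by apply/asboolP; exists k.
exists P; split=> // K KI PK KS.
have KT : [/\ ideal K, {subset J <= K} & forall x, x \in K -> ~ S x].
  by split=> // x /JP; apply: PK.
by have /asboolP := Pmax (exist _ K KT) (introT (asboolP _) PK).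
Qed.

Definition is_prime P : Prop :=
  [/\ ideal P, 1 \notin P & forall a b, a * b \in P -> a \in P \/ b \in P].

Lemma prime_exp P a k : is_prime P -> a ^+ k \in P -> a \in P.
Proof.
move=> [_ P1 PM]; elim: k => [|k IH]; first by rewrite expr0 (negPf P1).
by rewrite exprS => /PM[].
Qed.

Lemma prime_disjoint_exists J (S : A -> Prop) :
  ideal J -> S 1 -> (forall a b, S a -> S b -> S (a * b)) ->
  (forall x, x \in J -> ~ S x) ->
  exists P, [/\ is_prime P, {subset J <= P} & forall x, x \in P -> ~ S x].
Proof.
move=> JI S1 SM JS.
have [P [PI JP PS Pmax]] := maximal_disjoint_ideal JI JS.
have meets a : a \notin P -> exists u c, u \in P /\ S (u + c * a).
  move=> aP; apply: contrapT => nS; case/negP: aP.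
  apply: (Pmax (adjoin P a));
    [exact: adjoin_ideal|exact: adjoin_sub| |exact: adjoin_mem].
  by move=> _ /asboolP[u [c [uP ->]]] Sx; apply: nS; exists u, c.
exists P; split=> //; split=> //; first by apply/negP => /PS.
move=> a b abP; have [|/meets[u [c [uP Su]]]] := boolP (a \in P); first by left.
have [|/meets[v [d [vP Sv]]]] := boolP (b \in P); first by right.
have uvP : (u + c * a) * (v + d * b) \in P.
  have -> : (u + c * a) * (v + d * b) =
    (v + d * b) * u + (c * a * v + c * d * (a * b)) by ring.
  by rewrite !ideal_add// ideal_mull.
by case: (PS _ uvP); apply: SM.
Qed.

Lemma maximal_ideal_exists J : ideal J -> 1 \notin J ->
  exists M, maximal_ideal M /\ {subset J <= M}.
Proof.
move=> JI J1.
have [|M [MI JM M1 Mmax]] := maximal_disjoint_ideal JI (S := eq 1).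
  by move=> x xJ x1; rewrite x1 xJ in J1.
exists M; split=> //; split=> //; first by apply/negP => /M1.
by move=> K KI K1 MK; apply: Mmax => // x xK x1; rewrite x1 xK in K1.
Qed.

End Ideals.

Section Perfect.
Variables (A : comPzRingType) (P : {pred A}).
Hypotheses (A_perfect : perfect_ring A) (P_prime : is_prime P).

(** Otherwise one could choose, starting from 1, products that remain outside P
    and generate a strictly descending sequence of principal ideals. *)
Lemma perfect_minimal_principal :
  exists2 c, c \notin P & forall d, d \notin P -> exists z, c = c * d * z.
Proof.
apply: contrapT => noc; have [_ P1 PM] := P_prime.
have /choice[f fP] : forall c, exists d, c \notin P ->
    d \notin P /\ forall z, c <> c * d * z.
  move=> c; apply: contrapT => nod; apply: noc; exists c.
    by apply/negP => cP; apply: nod; exists 0; rewrite cP.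
  move=> d dP; apply: contrapT => noz; apply: nod; exists d => _.
  by split=> // z cE; apply: noz; exists z.
pose c := fix c k := if k is k'.+1 then c k' * f (c k') else 1.
have cP k : c k \notin P.
  elim: k => //= k ckP; apply/negP => /PM[]; first exact/negP.
  by apply/negP; case: (fP _ ckP).
have cE k : \prod_(0 <= l < k) f (c l) = c k.
  elim: k => [|k IH]; first by rewrite big_geq.
  by rewrite big_nat_recr//= IH.
have [k /(_ k.+1)[z]] := perfect_chain (fun l => f (c l)) A_perfect.
by rewrite !cE /=; case: (fP _ (cP k)) => _ neq /neq.
Qed.

(** With c as in [perfect_minimal_principal], c and c^2 generate the same ideal,
    which is then generated by an idempotent e; by minimality e is a multiple of
    e d for all d outside P.  For p in P, write p^k = p^(k+1) w; then p^k (1 - p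
    w) = 0, and 1 - p w lies outside P, so p^k kills e. *)
Lemma perfect_local_idempotent : exists e,
  [/\ e * e = e, e \notin P & forall p, p \in P -> exists k, p ^+ k * e = 0].
Proof.
have [c cP cmin] := perfect_minimal_principal.
have [PI P1 PM] := P_prime.
have [z cE] := cmin c cP; exists (c * z); split.
- by rewrite mulrACA mulrA -cE.
- apply/negP => czP; case/negP: cP; rewrite cE -mulrA; exact: ideal_mull.
move=> p pP; have [k /(_ k.+1)[w]] := perfect_chain (fun=> p) A_perfect.
rewrite !prodr_const_nat !subn0 => pE; exists k.
have /cmin[v vE] : 1 - p * w \notin P.
  apply/negP => pwP; case/negP: P1; rewrite -[1](subrK (p * w)).
  by rewrite ideal_add// ideal_mulr.
have p0 : p ^+ k * (1 - p * w) = 0.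
  by rewrite mulrBr mulr1 mulrA -exprSr -pE subrr.
rewrite vE; have -> : p ^+ k * (c * (1 - p * w) * v * z) =
  p ^+ k * (1 - p * w) * (c * v * z) by ring.
by rewrite p0 mul0r.
Qed.

End Perfect.

(** The extension of P to the total quotient ring is a prime; y and t are a
    numerator and a denominator of the idempotent that
    [perfect_local_idempotent] finds there. *)
Lemma subperfect_local_idempotent (A : comPzRingType) (P : {pred A}) :
  subperfect A -> is_prime P -> (forall x, x \in P -> ~ GRing.lreg x) ->
  exists y t, [/\ GRing.lreg t, y * y = t * y, y \notin P
    & forall p, p \in P -> exists k, p ^+ k * y = 0].
Proof.
move=> [Q [iota [[iota_inj iota_unit iota_frac] Q_perfect]]] PP Preg.
have [PI P1 PM] := PP.
pose PQ : {pred Q} := fun q => `[< exists p s,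
  [/\ p \in P, GRing.lreg s & q * iota s = iota p] >].
have regP s a : GRing.lreg s -> s * a \in P -> a \in P.
  by move=> s_reg /PM[/Preg|].
have PQ_prime : is_prime PQ.
  split; first split.
  - apply/asboolP; exists 0, 1; split; [by case: PI|exact: GRing.lreg1|].
    by rewrite mul0r rmorph0.
  - move=> q u v /asboolP[a [s [aP s_reg uE]]] /asboolP[b [t [bP t_reg vE]]].
    have [c [r [r_reg cE]]] := iota_frac q.
    apply/asboolP; exists (c * t * a + r * s * b), (r * s * t); split.
    + by apply: ideal_add => //; apply: ideal_mull.
    + by do !apply: GRing.lregM.
    + by rewrite rmorphD !rmorphM -uE -vE -cE; ring.
  - apply/negP => /asboolP[p [s [pP s_reg]]].
    by rewrite mul1r => /iota_inj sp; apply: (Preg s) => //; rewrite sp.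
  - move=> u v /asboolP[p [r [pP r_reg uvE]]].
    have [a [s [s_reg aE]]] := iota_frac u.
    have [b [t [t_reg bE]]] := iota_frac v.
    have abE : r * (a * b) = s * t * p.
      by apply: iota_inj; rewrite !rmorphM -aE -bE -uvE; ring.
    have /(regP _ _ r_reg)/PM[aP|bP] : r * (a * b) \in P.
      by rewrite abE ideal_mull.
    - by left; apply/asboolP; exists a, s.
    - by right; apply/asboolP; exists b, t.
have [e [eE eP enil]] := perfect_local_idempotent Q_perfect PQ_prime.
have [y [t [t_reg yE]]] := iota_frac e.
exists y, t; split=> //.
- by apply: iota_inj; rewrite !rmorphM -yE -{3}eE; ring.
- by apply: contra eP => yP; apply/asboolP; exists y, t.
move=> p pP; have [|k pk] := enil (iota p).
  apply/asboolP; exists p, 1; split=> //; first exact: GRing.lreg1.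
  by rewrite rmorph1 mulr1.
exists k; apply: iota_inj.
by rewrite rmorph0 rmorphM rmorphXn/= -yE mulrA pk mul0r.
Qed.

(** * Regular sequences and chains of primes *)

Section RegularSequences.
Variable A : comPzRingType.
Implicit Types (s : seq A) (x y z : A) (I P M : {pred A}).

Lemma seq_ideal_ideal s : ideal (seq_ideal s).
Proof.
split=> [|a u v us vs]; first exact: rpred0.
by rewrite rpredD// seq_idealM.
Qed.

Lemma seq_ideal_nil x : x \in seq_ideal [::] -> x = 0.
Proof. by move=> /asboolP[c ->]; rewrite big_ord0. Qed.

Lemma seq_ideal_rcons s z : seq_ideal (rcons s z) =i adjoin (seq_ideal s) z.
Proof.
move=> x; apply/idP/idP => /asboolP.
  move=> [c ->]; apply/asboolP; rewrite size_rcons big_ord_recr/=.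
  exists (\sum_(i < size s) c i * s`_i), (c (size s)); split.
    by apply/asboolP; exists c.
  rewrite nth_rcons ltnn eqxx; congr (_ + _).
  by apply: eq_bigr => i _; rewrite nth_rcons ltn_ord.
move=> [u [d [/asboolP[c ->] ->]]]; apply/asboolP.
exists (fun i => if (i < size s)%N then c i else d).
rewrite size_rcons big_ord_recr/= nth_rcons ltnn eqxx; congr (_ + _).
by apply: eq_bigr => i _; rewrite nth_rcons ltn_ord.
Qed.

Lemma seq_ideal_min s I : ideal I -> {subset s <= I} ->
  {subset seq_ideal s <= I}.
Proof.
move=> II sI x /asboolP[c ->]; apply: ideal_sum => // i _.
by apply: ideal_mull => //; apply/sI/mem_nth.
Qed.

Lemma seq_ideal_mem s : {subset s <= seq_ideal s}.
Proof.
elim/last_ind: s => // s z IH x.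
rewrite mem_rcons inE seq_ideal_rcons => /predU1P[->|/IH].
  exact/adjoin_mem/seq_ideal_ideal.
exact: adjoin_sub.
Qed.

Definition reg_mod s z : Prop :=
  forall b, z * b \in seq_ideal s -> b \in seq_ideal s.

Lemma seq_proj_eq0 s x : seq_proj s x = 0 <-> x \in seq_ideal s.
Proof.
rewrite -(raddf0 (seq_proj s)); split=> [/eqP|xs].
  by rewrite seq_proj_eq subr0.
by apply/eqP; rewrite seq_proj_eq subr0.
Qed.

Lemma reg_modP s z : reg_mod s z <-> GRing.lreg (seq_proj s z).
Proof.
split=> [z_reg u v|z_reg b /seq_proj_eq0].
  have [a ->] := seq_proj_surj u; have [b ->] := seq_proj_surj v.
  move/eqP; rewrite -subr_eq0 -mulrBr -raddfB -rmorphM => /eqP/seq_proj_eq0.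
  move=> /z_reg/seq_proj_eq0; rewrite raddfB => /eqP.
  by rewrite subr_eq0 => /eqP.
rewrite rmorphM -[RHS](mulr0 (seq_proj s z)) => /z_reg.
by move/seq_proj_eq0.
Qed.

Lemma reg_mod_nil z : reg_mod [::] z <-> GRing.lreg z.
Proof.
split=> [z_reg a b /eqP|z_reg b /seq_ideal_nil zb0].
  rewrite -subr_eq0 -mulrBr => /eqP zab.
  have /z_reg/seq_ideal_nil/eqP : z * (a - b) \in seq_ideal [::].
    by rewrite zab; case: (seq_ideal_ideal [::]).
  by rewrite subr_eq0 => /eqP.
have -> : b = 0 by apply: z_reg; rewrite zb0 mulr0.
by case: (seq_ideal_ideal [::]).
Qed.

Lemma reg_mod1 s : reg_mod s 1.
Proof. by move=> b; rewrite mul1r. Qed.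

Lemma reg_modM s x y : reg_mod s x -> reg_mod s y -> reg_mod s (x * y).
Proof. by move=> x_reg y_reg b; rewrite -mulrA => /x_reg/y_reg. Qed.

Lemma reg_modX s x k : reg_mod s x -> reg_mod s (x ^+ k).
Proof.
by move=> x_reg; elim: k => [|k IH]; rewrite ?expr0 ?exprS;
  [apply: reg_mod1|apply: reg_modM].
Qed.

Lemma regular_seq_rcons s z : regular_seq s -> reg_mod s z ->
  (exists a, a \notin seq_ideal (rcons s z)) -> regular_seq (rcons s z).
Proof.
move=> s_reg /reg_modP z_reg za; right; split=> // j.
rewrite size_rcons ltnS leq_eqVlt => /predU1P[->|js].
  by rewrite -cats1 take_size_cat// nth_cat ltnn subnn.
rewrite -cats1 takel_cat ?(ltnW js)// nth_cat js.
by case: s_reg => [s0|[_ +]]; [rewrite s0 in js|apply].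
Qed.

Lemma regular_seq_rcons_reg s z : regular_seq (rcons s z) -> reg_mod s z.
Proof.
case=> [/(congr1 size)|[_ /(_ (size s))]]; first by rewrite size_rcons.
rewrite size_rcons ltnSn -cats1 take_size_cat// nth_cat ltnn subnn => h.
by apply/reg_modP/h.
Qed.

Lemma regular_seq_take s k : regular_seq s -> regular_seq (take k s).
Proof.
case=> [->|[[a as_] s_reg]]; first by left.
right; split=> [|j].
  exists a; apply: contra as_.
  apply: seq_ideal_min; first exact: seq_ideal_ideal.
  by move=> x /mem_take; apply: seq_ideal_mem.
have [sk|ks] := leqP (size s) k; first by rewrite take_oversize//; apply: s_reg.
rewrite size_takel ?(ltnW ks)// => jk.
rewrite take_takel ?(ltnW jk)// nth_take//.
by apply: s_reg; apply: ltn_trans ks.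
Qed.

(** If no prolongation inside I is maximal, then choosing one more term again
    and again yields an infinite sequence all of whose initial parts are
    regular. *)
Lemma maximal_regular_seq_extend I s :
  ~ (exists x : nat -> A, forall k, regular_seq (mkseq x k)) ->
  regular_seq s -> {subset s <= I} ->
  exists2 s', maximal_regular_seq_in I s' & (size s <= size s')%N.
Proof.
move=> fin s_reg sI; apply: contrapT => nomax.
have /choice[f fP] : forall t, exists x,
    regular_seq t -> {subset t <= I} -> (size s <= size t)%N ->
    x \in I /\ regular_seq (rcons t x).
  move=> t; apply: contrapT => nox; apply: nomax; exists t; last first.
    by apply: contrapT => st; apply: nox; exists 0 => _ _ /st.
  split.
  - by apply: contrapT => t_reg; apply: nox; exists 0 => /t_reg.
  - by apply: contrapT => tI; apply: nox; exists 0 => _ /tI.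
  by move=> x xI tx_reg; apply: nox; exists x.
pose t := fix t k := if k is k'.+1 then rcons (t k') (f (t k')) else s.
have size_t k : size (t k) = (size s + k)%N.
  by elim: k => [|k IH]/=; rewrite ?addn0// size_rcons IH addnS.
have tP k : regular_seq (t k) /\ {subset t k <= I}.
  elim: k => //= k [tk_reg tkI].
  have [|xI tx_reg] := fP _ tk_reg tkI; first by rewrite size_t leq_addr.
  split=> // y; rewrite mem_rcons inE => /predU1P[->//|]; exact: tkI.
have nth_t i j k : (i < size (t j))%N -> (j <= k)%N -> (t k)`_i = (t j)`_i.
  move=> ij; elim: k => [|k IH]; first by rewrite leqn0 => /eqP->.
  rewrite leq_eqVlt => /predU1P[->//|jk]; rewrite -IH//= nth_rcons.
  by rewrite (leq_trans ij)// !size_t leq_add2l.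
apply: fin; exists (fun i => (t i.+1)`_i) => k.
suff -> : mkseq (fun i => (t i.+1)`_i) k = take k (t k).
  by apply/regular_seq_take/(tP k).1.
have sk : size (take k (t k)) = k by rewrite size_takel// size_t leq_addl.
apply: (@eq_from_nth _ 0); rewrite size_mkseq// => i ik.
rewrite nth_mkseq// nth_take// (@nth_t i i.+1 k)//.
by rewrite size_t addnS ltnS leq_addl.
Qed.

(** When A / (s) is subperfect these are the minimal primes over (s); this form
    is the one that passes from s to a longer sequence. *)
Definition zero_divisor_prime s P : Prop :=
  [/\ is_prime P, {subset s <= P} & forall z, z \in P -> ~ reg_mod s z].

(** [subperfect_local_idempotent] for A / (s), read in A. *)
Lemma zero_divisor_prime_local s P :
  subperfect (seq_quot s) -> zero_divisor_prime s P ->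
  exists y t, [/\ reg_mod s t, y * y - t * y \in seq_ideal s, y \notin P
    & forall p, p \in P -> exists k, p ^+ k * y \in seq_ideal s].
Proof.
move=> s_sub [PP sP Preg]; have [PI P1 PM] := PP.
pose P' : {pred seq_quot s} :=
  fun q => `[< exists2 p, p \in P & q = seq_proj s p >].
have memP' a : (seq_proj s a \in P') = (a \in P).
  apply/idP/idP => [/asboolP[p pP /eqP]|aP]; last by apply/asboolP; exists a.
  rewrite seq_proj_eq => /(seq_ideal_min PI sP) apP.
  by rewrite -[a](subrK p) ideal_add.
have P'_prime : is_prime P'.
  split; first split.
  - by rewrite -(raddf0 (seq_proj s)) memP'; case: PI.
  - move=> c u v; have [a ->] := seq_proj_surj c.
    have [p ->] := seq_proj_surj u; have [q ->] := seq_proj_surj v.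
    rewrite -rmorphM -raddfD !memP' => pP qP.
    by rewrite ideal_add// ideal_mull.
  - by rewrite -(rmorph1 (seq_proj s)) memP'.
  - move=> u v; have [a ->] := seq_proj_surj u; have [b ->] := seq_proj_surj v.
    by rewrite -rmorphM !memP'; apply: PM.
have [q qP' q_reg|y' [t' []]] := subperfect_local_idempotent s_sub P'_prime.
  have [z zE] := seq_proj_surj q; move: qP' q_reg.
  by rewrite zE memP' => /Preg nz /reg_modP.
have [y ->] := seq_proj_surj y'; have [t ->] := seq_proj_surj t'.
move=> /reg_modP t_reg yE yP' ynil; exists y, t; split=> //.
- by rewrite -seq_proj_eq !rmorphM yE.
- by rewrite -memP'.
move=> p pP; have [|k pk] := ynil (seq_proj s p); first by rewrite memP'.
by exists k; apply/seq_proj_eq0; rewrite rmorphM rmorphXn.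
Qed.

(** Each strict inclusion provides one more term.  If all the elements of
    P_{i+1} were zero-divisors modulo s, [zero_divisor_prime_local] would give y
    outside P_{i+1} such that each p in P_{i+1} satisfies p^m y in (s), which is
    contained in P_i; since y is not in P_i, p would be. *)
Lemma regular_seq_in_chain (P : nat -> {pred A}) k :
  regularly_subperfect A ->
  (forall i, (i <= k)%N -> is_prime (P i)) ->
  (forall i, (i < k)%N -> {subset P i <= P i.+1} /\ ~ {subset P i.+1 <= P i}) ->
  exists s, [/\ regular_seq s, size s = k & {subset s <= P k}].
Proof.
move=> A_sub Pprime Pstrict.
suff: forall i, (i <= k)%N ->
    exists s, [/\ regular_seq s, size s = i & {subset s <= P i}].
  by apply.
elim=> [|i IH] ik; first by exists [::]; split=> //; left.
have [s [s_reg si sP]] := IH (ltnW ik); have [PiS PSi] := Pstrict i ik.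
have [[z zP z_reg]|noz] := pselect (exists2 z, z \in P i.+1 & reg_mod s z).
  have sub : {subset rcons s z <= P i.+1}.
    by move=> x; rewrite mem_rcons inE => /predU1P[->//|/sP/PiS].
  exists (rcons s z); split=> //; last by rewrite size_rcons si.
  have [PI P1 _] := Pprime _ ik; apply: regular_seq_rcons => //.
  by exists 1; apply: contra P1; apply: seq_ideal_min.
case: PSi => p pP.
have [|y [t [_ _ yP ynil]]] :=
  @zero_divisor_prime_local s (P i.+1) (A_sub s s_reg).
  split=> [|x /sP/PiS//|z zP z_reg]; first exact: Pprime.
  by apply: noz; exists z.
have [m pm] := ynil p pP; have [PI _ PM] := Pprime _ (ltnW ik).
have /PM[/prime_exp->//|/PiS] := seq_ideal_min PI sP pm.
  exact/Pprime/ltnW.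
by rewrite (negPf yP).
Qed.

(** In a Noetherian ring one would find x and P' by applying Nakayama's lemma to
    the annihilator of P; here the local idempotent replaces it.  Once x and y
    are found, an element p + c x with p in P cannot be regular modulo (s, x),
    because its k-th power is p^k modulo x, and p^k sends y into (s).  So P +
    (x) is disjoint from the multiplicative set of regular elements modulo (s,
    x), and P' is a prime containing the former and disjoint from the latter. *)
Lemma zero_divisor_prime_step s P :
  regularly_subperfect A -> regular_seq s -> zero_divisor_prime s P ->
  (forall M, maximal_ideal M -> {subset s <= M} ->
    exists2 x, x \in M & reg_mod s x) ->
  exists x P', [/\ regular_seq (rcons s x), zero_divisor_prime (rcons s x) P',
    {subset P <= P'} & ~ {subset P' <= P}].
Proof.
move=> A_sub s_reg Pzd Mreg.
have [PP sP Preg] := Pzd; have [PI P1 PM] := PP.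
have sPI := seq_ideal_min PI sP.
have IsI := seq_ideal_ideal s.
have [x [y [x_reg yx ynil]]] : exists x y, [/\ reg_mod s x,
    y \notin seq_ideal (rcons s x)
    & forall p, p \in P -> exists k, p ^+ k * y \in seq_ideal s].
  have [y [t [t_reg yty yP ynil]]] :=
    zero_divisor_prime_local (A_sub s s_reg) Pzd.
  have [yt|yt] := boolP (y \in seq_ideal (rcons s t)); last by exists t, y.
  move: yt; rewrite seq_ideal_rcons => /asboolP[u [b [us yE]]].
  (* Here y = t b modulo s: the idempotent y / t is the class of b. *)
  have bb : b * (1 - b) \in P.
    apply/sPI/t_reg/t_reg.
    have -> : t * (t * (b * (1 - b))) =
        (2 * b * t + u - t) * u - (y * y - t * y) by rewrite yE; ring.
    by rewrite ideal_sub// ideal_mull.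
  have bP : b \notin P.
    by apply: contra yP => bP; rewrite yE ideal_add ?(sPI u us)// ideal_mulr.
  have b1P : 1 - b \in P by case/PM: bb => //; rewrite (negPf bP).
  have [M [Mmax PsubM]] := maximal_ideal_exists PI P1.
  have [x xM x_reg] := Mreg M Mmax (fun z zs => PsubM _ (sP _ zs)).
  have [MI M1 _] := Mmax; exists x, b; split=> //.
    apply: contra M1; rewrite seq_ideal_rcons => /asboolP[v [c [vs bE]]].
    have bM : b \in M.
      by rewrite bE ideal_add ?(PsubM v (sPI v vs))// ideal_mull.
    by rewrite -[1](subrK b) ideal_add// PsubM.
  move=> p pP; have [k pk] := ynil p pP; exists k; apply: t_reg.
  have -> : t * (p ^+ k * b) = p ^+ k * y - p ^+ k * u by rewrite yE; ring.
  by rewrite ideal_sub// ideal_mull.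
have sx_reg : regular_seq (rcons s x).
  by apply: regular_seq_rcons => //; exists y.
have IsxI := seq_ideal_ideal (rcons s x).
have xsx : x \in seq_ideal (rcons s x).
  by rewrite seq_ideal_mem// mem_rcons mem_head.
have [|||z /asboolP[p [c [pP zE]]] z_reg|P' [P'P PP' P'reg]] :=
  @prime_disjoint_exists A (adjoin P x) (reg_mod (rcons s x)).
- exact: adjoin_ideal.
- exact: reg_mod1.
- exact: reg_modM.
- have [k pk] := ynil p pP; case/negP: yx.
  apply: (@reg_modX _ _ k z_reg y); rewrite zE.
  have : (p + c * x) ^+ k - p ^+ k \in seq_ideal (rcons s x).
    rewrite subrXX [X in X * _]addrC addKr mulrC ideal_mull// ideal_mull//.
  move=> h; rewrite -[_ ^+ k](subrK (p ^+ k)) mulrDl.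
  apply: ideal_add => //; first exact: ideal_mulr.
  by rewrite seq_ideal_rcons; apply: adjoin_sub.
have PP'' : {subset P <= P'} by move=> p pP; apply/PP'/adjoin_sub.
have xP' : x \in P' by apply/PP'/adjoin_mem.
exists x, P'; split=> //; last by move=> /(_ x xP')/Preg.
split=> // z; rewrite mem_rcons inE => /predU1P[->//|/sP]; exact: PP''.
Qed.

Lemma zero_divisor_prime_chain n P0 :
  n_subperfect n A -> zero_divisor_prime [::] P0 ->
  exists P : nat -> {pred A}, [/\ P 0%N = P0,
    forall i, (i <= n)%N -> is_prime (P i)
    & forall i, (i < n)%N ->
        {subset P i <= P i.+1} /\ ~ {subset P i.+1 <= P i}].
Proof.
move=> [A_sub _ _ Mgrade] P0zd.
suff: forall i, (i <= n)%N -> exists (s : seq A) (P : nat -> {pred A}),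
    [/\ size s = i, regular_seq s, zero_divisor_prime s (P i) & P 0%N = P0] /\
    (forall j, (j <= i)%N -> is_prime (P j)) /\
    (forall j, (j < i)%N -> {subset P j <= P j.+1} /\ ~ {subset P j.+1 <= P j}).
  by move=> /(_ n (leqnn n))[s [P [[_ _ _ P00] [Pp Ps]]]]; exists P.
elim=> [_|i IH i_n].
  exists [::], (fun=> P0); split; first by split=> //; left.
  by split=> // j _; case: P0zd.
have [s [P [[si s_reg Pzd P00] [Pp Ps]]]] := IH (ltnW i_n).
have [M Mmax sM|x [P' [sx_reg P'zd PP' P'P]]] :=
    zero_divisor_prime_step A_sub s_reg Pzd.
  apply: contrapT => nox; suff smax : maximal_regular_seq_in M s.
    by move: i_n; rewrite -si (Mgrade M Mmax s smax) ltnn.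
  split=> // x xM sx_reg; apply: nox; exists x => //.
  exact: regular_seq_rcons_reg.
exists (rcons s x), (fun j => if (j <= i)%N then P j else P').
rewrite size_rcons si ltnn; split=> //; split=> j.
  rewrite leq_eqVlt ltnS => /predU1P[->|ji].
    by rewrite ltnn; case: P'zd.
  by rewrite ji; apply: Pp.
rewrite ltnS => ji; rewrite ji; move: ji.
rewrite leq_eqVlt => /predU1P[->|ji]; first by rewrite ltnn.
by rewrite ji; apply: Ps.
Qed.

Lemma prime_chain_length n (P : nat -> {pred A}) k :
  n_subperfect n A ->
  (forall i, (i <= k)%N -> is_prime (P i)) ->
  (forall i, (i < k)%N -> {subset P i <= P i.+1} /\ ~ {subset P i.+1 <= P i}) ->
  (k <= n)%N.
Proof.
move=> [A_sub max_n fin _] Pp Ps.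
have [s [s_reg <- _]] := regular_seq_in_chain A_sub Pp Ps.
by have [//|s' /max_n <-] := @maximal_regular_seq_extend predT s fin s_reg.
Qed.

End RegularSequences.

(** * Fraction fields, quotients by primes, products *)

Lemma fraction_numden (D : idomainType) (x : {fraction D}) :
  exists a b : D, b != 0 /\ x * FracField.tofrac b = FracField.tofrac a.
Proof.
rewrite -[x]reprK; set r := repr x.
exists (frac r).1, (frac r).2; split; first exact: denom_ratioP.
unlock FracField.tofrac; rewrite -[LHS]FracField.pi_mul.
apply/eqmodP => /=; rewrite FracField.equivfE /FracField.mulf.
by rewrite !numden_Ratio ?mulf_neq0 ?oner_neq0 ?denom_ratioP// !mulr1 mulrC.
Qed.

(** An idomainType carries an inverse function on its units; on a domain it can
    be chosen classically. *)
Section ClassicalDomain.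
Variable D : comNzRingType.
Hypothesis D_integral : forall x y : D, x * y = 0 -> (x == 0) || (y == 0).

Let unit_pred : {pred D} := fun x => `[< exists y, y * x = 1 >].
Let inv_fun (x : D) : D :=
  if pselect (exists y, y * x = 1) is left e then sval (cid e) else x.

Let mulVx : {in unit_pred, left_inverse 1 inv_fun *%R}.
Proof.
move=> x /asboolP xu; rewrite /inv_fun; case: pselect => // e.
by case: (cid e).
Qed.

Let unitPl x y : y * x = 1 -> unit_pred x.
Proof. by move=> yx; apply/asboolP; exists y. Qed.

Let invr_out : {in [predC unit_pred], inv_fun =1 id}.
Proof.
move=> x /negP xn; rewrite /inv_fun; case: pselect => // e.
by case: xn; apply/asboolP.
Qed.

Lemma classical_idomain : exists (E : idomainType) (f : {rmorphism D -> E}),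
  bijective f.
Proof.
pose mu := GRing.ComNzRing_hasMulInverse.Build D mulVx unitPl invr_out.
pose U : comUnitRingType := HB.pack (D : Type) D mu.
pose mi := GRing.ComUnitRing_isIntegral.Build U D_integral.
pose E : idomainType := HB.pack (U : Type) U mi.
exists E.
exists (GRing.RMorphism.clone D E (@idfun D) (@idfun D : {rmorphism D -> D})).
by exists id.
Qed.

End ClassicalDomain.

Record prime_quotient (A : comPzRingType) (P : {pred A}) := PrimeQuotient {
  pq_dom : idomainType;
  pq_proj : {rmorphism A -> pq_dom};
  pq_surj : forall d, exists a, pq_proj a = d;
  pq_ker : forall a, pq_proj a = 0 <-> a \in P }.

Arguments pq_surj {A P} _ d.
Arguments pq_ker {A P} _ a.

Lemma prime_quotient_nz (A : comNzRingType) (P : {pred A}) :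
  is_prime P -> inhabited (prime_quotient P).
Proof.
move=> [[P0 PD] P1 PM].
have P_ideal : idealr_closed P by [].
have P_prime : prime_idealr_closed P.
  by move=> u v /PM[]->; rewrite ?orbT.
pose mz := GRing.isZmodClosed.Build A P (idealr_closedB P_ideal).
pose mi := isProperIdeal.Build A P (idealr_closed_nontrivial P_ideal).
pose mp := isPrimeIdealrClosed.Build A P P_prime.
pose I : prime_idealr A := HB.pack (P : A -> bool) mz mi mp.
have [E [f [g fK gK]]] :=
  @classical_idomain {ideal_quot I} (@Quotient.rquot_IdomainAxiom A I).
split; apply: (@PrimeQuotient A P E (f \o \pi_{ideal_quot I})) => [d|a].
  by exists (repr (g d)); rewrite /= reprK gK.
have piE : (a \in P) = (\pi_{ideal_quot I} a == \pi_{ideal_quot I} 0).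
  by rewrite -[a in LHS]subr0 -[RHS]Quotient.idealrBE.
rewrite piE -(inj_eq (can_inj fK)) /= !rmorph0; split=> [->|/eqP] //.
Qed.

Lemma prime_quotient_exists (A : comPzRingType) (P : {pred A}) :
  is_prime P -> inhabited (prime_quotient P).
Proof.
move=> PP; have A_nz : (1 : A) != 0.
  by case: PP => -[P0 _] P1 _; apply: contraNneq P1 => ->.
pose A' : comNzRingType :=
  HB.pack (A : Type) A (GRing.PzSemiRing_isNonZero.Build A A_nz).
have [[E f f_surj f_ker]] := @prime_quotient_nz A' P PP.
by split; exact: (@PrimeQuotient A P E f f_surj f_ker).
Qed.

Section ProductMaps.
Variables (m : nat) (D : 'I_m -> comPzRingType).

Definition prod_proj (j : 'I_m) (x : prod_ring D) : D j := x j.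

Fact prod_proj_zmod_morphism j : zmod_morphism (prod_proj j).
Proof. by move=> x y; rewrite /prod_proj !ffunE. Qed.

HB.instance Definition _ j := GRing.isZmodMorphism.Build (prod_ring D) (D j)
  (prod_proj j) (prod_proj_zmod_morphism j).

Fact prod_proj_monoid_morphism j : monoid_morphism (prod_proj j).
Proof. by split=> [|x y]; rewrite /prod_proj ffunE. Qed.

HB.instance Definition _ j := GRing.isMonoidMorphism.Build (prod_ring D) (D j)
  (prod_proj j) (prod_proj_monoid_morphism j).

Variables (A : comPzRingType) (f : forall j, {rmorphism A -> D j}).

Definition prod_map (a : A) : prod_ring D := [ffun j => f j a : D j].

Fact prod_map_zmod_morphism : zmod_morphism prod_map.
Proof. by move=> a b; apply/ffunP => j; rewrite !ffunE rmorphB. Qed.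

HB.instance Definition _ := GRing.isZmodMorphism.Build A (prod_ring D)
  prod_map prod_map_zmod_morphism.

Fact prod_map_monoid_morphism : monoid_morphism prod_map.
Proof.
by split=> [|a b]; apply/ffunP => j; rewrite !ffunE ?rmorph1 ?rmorphM.
Qed.

HB.instance Definition _ := GRing.isMonoidMorphism.Build A (prod_ring D)
  prod_map prod_map_monoid_morphism.

End ProductMaps.

(** The primes of A / P0 are those of A that contain P0.  The upper bound holds
    for all chains of primes of A; the lower bound comes from the chain of
    length n that starts at P0. *)
Lemma krull_dim_quotient (A : comPzRingType) (n : nat) (P0 : {pred A})
    (D : comNzRingType) (f : {rmorphism A -> D}) :
  (forall d, exists a, f a = d) -> (forall a, f a = 0 <-> a \in P0) ->
  n_subperfect n A -> zero_divisor_prime [::] P0 -> krull_dim D n.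
Proof.
move=> f_surj f_ker A_n P0zd; split=> [|k P [Pp Ps]]; last first.
  apply: (@prime_chain_length A n (fun i a => P i (f a)) k A_n) => i ik.
    have [[P0i P1i PDi] PMi] := Pp i ik.
    have memE x : (x \in (fun a => P i (f a))) = (f x \in P i) by [].
    split; first split.
    + by rewrite memE rmorph0.
    + by move=> a u v; rewrite !memE rmorphD rmorphM; apply: PDi.
    + by rewrite memE rmorph1.
    + by move=> a b; rewrite !memE rmorphM => /PMi/orP.
  have [PS nPS] := Ps i ik; split=> [a|PS']; first exact: PS.
  by apply: nPS => d; have [a <-] := f_surj d; apply: PS'.
have [P [P0E Pp Ps]] := zero_divisor_prime_chain A_n P0zd.
have P0P i : (i <= n)%N -> {subset P0 <= P i}.
  elim: i => [|i IH] i_n; first by rewrite P0E.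
  by move=> x /(IH (ltnW i_n)); case: (Ps i i_n) => + _; apply.
pose Q i : {pred D} := fun d => `[< exists2 a, a \in P i & f a = d >].
have memQ i a : (i <= n)%N -> (f a \in Q i) = (a \in P i).
  move=> i_n; apply/idP/idP => [/asboolP[b bP /eqP]|aP]; last first.
    by apply/asboolP; exists a.
  rewrite eq_sym -subr_eq0 -rmorphB => /eqP/f_ker/(P0P i i_n) abP.
  by rewrite -[a](subrK b) ideal_add//; case: (Pp i i_n).
exists Q; split=> i i_n.
  have [PI P1 PM] := Pp i i_n; split; first split.
  - by rewrite -(rmorph0 f) memQ//; case: PI.
  - by rewrite -(rmorph1 f) memQ.
  - move=> c u v; have [a <-] := f_surj c; have [p <-] := f_surj u.
    have [q <-] := f_surj v; rewrite -rmorphM -rmorphD !memQ// => pP qP.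
    by rewrite ideal_add// ideal_mull.
  - move=> u v; have [a <-] := f_surj u; have [b <-] := f_surj v.
    by rewrite -rmorphM !memQ// => /PM/orP.
have [PS nPS] := Ps i i_n; have i_n' := ltnW i_n; split=> [d|QS].
  by have [a <-] := f_surj d; rewrite (memQ i a i_n') (memQ _ a i_n); apply: PS.
by apply: nPS => a; rewrite -(memQ i a i_n') -(memQ _ a i_n); apply: QS.
Qed.

(** * Reduced rings and orthogonal atoms *)

Section Atoms.
Variable A : comPzRingType.
Implicit Types (y a b : A) (ys : seq A).

(** The annihilator of y is a prime ideal.  When the total quotient ring of A is
    a product of fields, the atoms are the nonzero elements of A that lie in a
    single factor. *)
Definition atom y : Prop :=
  y != 0 /\ forall a b, a * b * y = 0 -> a * y = 0 \/ b * y = 0.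

Definition ann y : {pred A} := fun a => `[< a * y = 0 >].

Lemma ann_ideal y : ideal (ann y).
Proof.
split=> [|a u v /asboolP uy /asboolP vy]; apply/asboolP; rewrite ?mul0r//.
by rewrite mulrDl -mulrA uy vy mulr0 addr0.
Qed.

Lemma atom_zero_divisor_prime y : atom y -> zero_divisor_prime [::] (ann y).
Proof.
move=> [y0 yM]; split=> // [|z /asboolP zy /reg_mod_nil z_reg].
  split; first exact: ann_ideal.
  - by apply/negP => /asboolP; rewrite mul1r => /eqP; rewrite (negPf y0).
  - by move=> a b /asboolP/yM[ay|byy]; [left|right]; apply/asboolP.
by move/eqP: y0; apply; apply: z_reg; rewrite zy mulr0.
Qed.

(** In a reduced ring p^k y = 0 gives p y = 0, so the element y of
    [zero_divisor_prime_local] has annihilator exactly P. *)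
Lemma reduced_atom_exists P :
  reduced A -> subperfect (seq_quot ([::] : seq A)) ->
  zero_divisor_prime [::] P -> exists2 y, y \notin P & atom y.
Proof.
move=> A_red A_sub Pzd; have [[[P0 PD] P1 PM] _ _] := Pzd.
have [y [_ [_ _ yP ynil]]] := zero_divisor_prime_local A_sub Pzd.
have Py p : p \in P -> p * y = 0.
  move=> /ynil[k /seq_ideal_nil pk]; apply: (A_red _ k.+1).
  have -> : (p * y) ^+ k.+1 = (p ^+ k * y) * (p * y ^+ k).
    by rewrite exprS exprMn; ring.
  by rewrite pk mul0r.
have annP a : a * y = 0 -> a \in P.
  by move=> ay; have /PM[//|] : a * y \in P; rewrite ?ay// (negPf yP).
exists y => //; split; first by apply: contra yP => /eqP->.
by move=> a b /annP/PM[]/Py; [left|right].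
Qed.

(** A prime made of zero-divisors misses some atom, so the ideal generated by
    all the atoms lies in no such prime, and therefore contains a
    non-zero-divisor. That element is a combination of finitely many atoms, and
    an element killing all of them kills it. *)
Lemma atoms_joint_annihilator :
  reduced A -> subperfect (seq_quot ([::] : seq A)) ->
  exists ys, (forall y, y \in ys -> atom y) /\
    forall a, (forall y, y \in ys -> a * y = 0) -> a = 0.
Proof.
move=> A_red A_sub.
pose J : {pred A} := fun x => `[< exists2 ys,
  (forall y, y \in ys -> atom y) & x \in seq_ideal ys >].
have JI : ideal J.
  split=> [|a u v /asboolP[ys ysA uys] /asboolP[zs zsA vzs]]; apply/asboolP.
    by exists [::] => //; case: (seq_ideal_ideal ([::] : seq A)).
  have II := seq_ideal_ideal (ys ++ zs); exists (ys ++ zs).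
    by move=> y; rewrite mem_cat => /orP[/ysA|/zsA].
  apply: ideal_add => //; first apply: ideal_mull => //.
    apply: (seq_ideal_min II) uys => x xys.
    by apply: seq_ideal_mem; rewrite mem_cat xys.
  apply: (seq_ideal_min II) vzs => x xzs.
  by apply: seq_ideal_mem; rewrite mem_cat xzs orbT.
have [[x /asboolP[ys ysA xys] x_reg]|noreg] :=
    pselect (exists2 x, x \in J & GRing.lreg x).
  exists ys; split=> // a ay; apply: x_reg; rewrite mulr0 mulrC.
  have : {subset ys <= [pred x | `[< a * x = 0 >]]}.
    by move=> y /ay ay0; apply/asboolP.
  move=> /seq_ideal_min h; apply/asboolP; apply: (h _ x xys).
  split=> [|c u v /asboolP au /asboolP av]; apply/asboolP; rewrite ?mulr0//.
  by rewrite mulrDr mulrCA au av mulr0 addr0.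
have [|||P [PP JP Preg]] := @prime_disjoint_exists A J (@GRing.lreg A) JI.
- exact: GRing.lreg1.
- exact: GRing.lregM.
- by move=> x xJ x_reg; apply: noreg; exists x.
have Pzd : zero_divisor_prime [::] P.
  by split=> // z zP /reg_mod_nil; apply: Preg.
have [y yP yA] := reduced_atom_exists A_red A_sub Pzd.
case/negP: yP; apply/JP/asboolP; exists [:: y].
  by move=> z; rewrite inE => /eqP->.
by apply: seq_ideal_mem; rewrite mem_head.
Qed.

(** An atom is dropped when its annihilator contains that of an atom already
    kept. Otherwise, for each kept z there is p with p z = 0 and p y <> 0; as p
    z lies in the prime ann(y) and p does not, z does, so that z y = 0. *)
Lemma atoms_orthogonal ys : (forall y, y \in ys -> atom y) ->
  exists zs, [/\ uniq zs, forall y, y \in zs -> atom y,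
    {in zs &, forall y z, y != z -> y * z = 0}
    & forall a, (forall z, z \in zs -> a * z = 0) ->
        forall y, y \in ys -> a * y = 0].
Proof.
elim: ys => [|y ys IH] ysA; first by exists [::]; split.
have [|zs [zsU zsA zsO zsann]] := IH.
  by move=> z zys; apply: ysA; rewrite inE zys orbT.
have yA : atom y by apply: ysA; rewrite mem_head.
have [[z zz zy]|nz] := pselect (exists2 z, z \in zs & {subset ann z <= ann y}).
  exists zs; split=> // a azs x.
  rewrite inE => /predU1P[->|]; last exact: zsann.
  by have /zy/asboolP : a \in ann z by apply/asboolP/azs.
have yzs z : z \in zs -> z * y = 0.
  move=> zzs; apply: contrapT => zy0; apply: nz; exists z => // p /asboolP pz.
  apply/asboolP; case: (yA.2 p z) => //; by rewrite pz mul0r.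
exists (y :: zs); split.
- rewrite /= zsU andbT; apply/negP => yy; apply: nz; by exists y.
- by move=> z; rewrite inE => /predU1P[->//|/zsA].
- move=> u v; rewrite !inE => /predU1P[->|uz] /predU1P[->|vz].
  + by rewrite eqxx.
  + by rewrite mulrC yzs.
  + by rewrite yzs.
  + exact: zsO.
move=> a az x; rewrite inE => /predU1P[->|].
  by apply: az; rewrite mem_head.
by apply: zsann => z zz; apply: az; rewrite inE zz orbT.
Qed.

Lemma reduced_subperfect_atoms :
  reduced A -> subperfect (seq_quot ([::] : seq A)) ->
  exists (m : nat) (y : 'I_m -> A),
    [/\ forall i, atom (y i), forall i j, i != j -> y i * y j = 0
      & forall a, (forall i, a * y i = 0) -> a = 0].
Proof.
move=> A_red A_sub.
have [ys [/atoms_orthogonal[zs [zsU zsA zsO zsann]] ysann]] :=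
  atoms_joint_annihilator A_red A_sub.
exists (size zs), (fun i => zs`_i); split=> [i|i j ij|a az].
- exact/zsA/mem_nth.
- by apply: zsO; rewrite ?mem_nth// nth_uniq.
apply/ysann/zsann => z /(nthP 0)[i iz <-]; exact: (az (Ordinal iz)).
Qed.

Section Family.
Variables (m : nat) (y : 'I_m -> A).
Hypothesis A_red : reduced A.
Hypothesis y_atom : forall i, atom (y i).
Hypothesis y_orth : forall i j, i != j -> y i * y j = 0.
Hypothesis y_ann : forall a, (forall i, a * y i = 0) -> a = 0.

Lemma atom_mul_neq0 i a b : a * y i != 0 -> b * y i != 0 -> a * b * y i != 0.
Proof.
by move=> /eqP ay /eqP byy; apply/eqP => /(y_atom i).2[].
Qed.

Lemma atom_sqr_neq0 i : y i * y i != 0.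
Proof.
by apply/eqP => yy; have [/eqP y0 _] := y_atom i; apply/y0/(A_red (k := 2)).
Qed.

Lemma sum_orthogonal (r : 'I_m -> A) i :
  (\sum_j r j * y j) * y i = r i * y i * y i.
Proof.
rewrite mulr_suml (bigD1 i)//= big1 ?addr0// => j ji.
by rewrite -mulrA y_orth// mulr0.
Qed.

(** Two nonzero multiples a y_i and b y_i have a nonzero product, since neither
    a, b nor y_i lies in the prime ann(y_i). *)
Lemma atoms_uniform_ideal i :
  uniform_ideal (fun x : A => `[< exists a, x = a * y i >]).
Proof.
have [y0 yM] := y_atom i; split.
  split.
    split=> [|a _ _ /asboolP[b ->] /asboolP[c ->]]; apply/asboolP.
      by exists 0; rewrite mul0r.
    by exists (a * b + c); ring.
  by exists (y i) => //; apply/asboolP; exists 1; rewrite mul1r.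
move=> J K [JI [u uJ u0]] [KI [v vK v0]] JU KU.
have /asboolP[a uE] := JU u uJ; have /asboolP[b vE] := KU v vK.
exists (u * v); split; [exact: ideal_mulr|exact: ideal_mull|].
have -> : u * v = a * b * y i * y i by rewrite uE vE; ring.
rewrite -mulrA; suff : a * b * y i * y i != 0 by rewrite !mulrA.
apply: atom_mul_neq0; last exact: atom_sqr_neq0.
by apply: atom_mul_neq0; rewrite -?uE -?vE.
Qed.

Lemma atoms_uniform_dim : uniform_dim A m.
Proof.
exists (fun i x => `[< exists a, x = a * y i >]); split.
- exact: atoms_uniform_ideal.
- move=> x xU x0 i; have /choice[r rE] : forall i, exists a, x i = a * y i.
    by move=> j; apply/asboolP/xU.
  have : (\sum_j r j * y j) * y i = 0.
    have -> : \sum_j r j * y j = \sum_j x j.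
      by apply: eq_bigr => j _; rewrite rE.
    by rewrite x0 mul0r.
  rewrite sum_orthogonal => ryy; rewrite rE; apply: (A_red (k := 2)).
  have -> : (r i * y i) ^+ 2 = r i * (r i * y i * y i) by ring.
  by rewrite ryy mulr0.
move=> J [JI [x xJ x0]].
have [i xy] : exists i, x * y i != 0.
  apply: contrapT => noi; move/eqP: x0; apply; apply: y_ann => i.
  by apply: contrapT => /eqP xy; apply: noi; exists i.
have sumE : \sum_j (if j == i then x * y i else 0) = x * y i.
  by rewrite -big_mkcond big_pred1_eq.
exists (fun j => if j == i then x * y i else 0); rewrite sumE; split=> // [j|].
  apply/asboolP; case: eqP => [->|_]; first by exists x.
  by exists 0; rewrite mul0r.
exact: ideal_mulr.
Qed.

(** If y_i does not annihilate S, say y_i x <> 0 with x in S, then a x = 0 puts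
    a in the prime ann(y_i).  Conversely a x is killed by every y_i.  So an
    annihilator is determined by a subset of the finite family. *)
Lemma annihilator_atoms (S : {pred A}) a :
  a \in annihilator S <->
  forall i, y i \notin annihilator S -> a * y i = 0.
Proof.
split=> [/asboolP aS i yS|aP]; last first.
  apply/asboolP => x xS; apply: y_ann => i.
  have [/asboolP yS|/aP ay] := boolP (y i \in annihilator S).
    by rewrite -mulrA [x * _]mulrC yS// mulr0.
  by rewrite mulrAC ay mul0r.
apply: contrapT => ay; case/negP: yS; apply/asboolP => x xS; rewrite mulrC.
by have [_ yM] := y_atom i; case: (yM a x) => //; rewrite aS// mul0r.
Qed.

(** By [annihilator_atoms] it suffices that the set of the i with y_i in the
    k-th annihilator become stationary; it increases with k inside a finite
    set. *)
Lemma atoms_acc_annihilators : acc_annihilators A.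
Proof.
move=> S Sinc; pose B k := [set i | y i \in annihilator (S k)].
have Bmono j k : (j <= k)%N -> B j \subset B k.
  elim: k => [|k IH]; first by rewrite leqn0 => /eqP->.
  rewrite leq_eqVlt => /predU1P[->//|/IH jk].
  apply: (fintype.subset_trans jk); apply/fintype.subsetP => i.
  by rewrite !finset.in_set; apply: Sinc.
pose c (d : nat) := `[< exists k, #|B k| = d >].
have c_ex : exists d, c d by exists #|B 0%N|; apply/asboolP; exists 0%N.
have c_le d : c d -> (d <= m)%N.
  by move=> /asboolP[k <-]; rewrite (leq_trans (max_card _))// card_ord.
have [_ /asboolP[N <-] Nmax] := ex_maxnP c_ex c_le.
exists N => k Nk; have BE : B k = B N.
  apply/eqP; rewrite eq_sym eqEcard Bmono//=; apply: Nmax.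
  by apply/asboolP; exists k.
have yE i : (y i \in annihilator (S k)) = (y i \in annihilator (S N)).
  by move/setP/(_ i): BE; rewrite !finset.in_set.
move=> a; apply/idP/idP => /annihilator_atoms aS; apply/annihilator_atoms => i.
  by rewrite -yE; apply: aS.
by rewrite yE; apply: aS.
Qed.

Lemma atoms_goldie : goldie A.
Proof.
by split; [exists m; apply: atoms_uniform_dim|apply: atoms_acc_annihilators].
Qed.

Section Components.
Variable (q : forall i, prime_quotient (ann (y i))).

Let D i := pq_dom (q i).
Let proj i : {rmorphism A -> D i} := pq_proj (q i).
Let f : {rmorphism A -> prod_ring (fun i => D i : comPzRingType)} :=
  prod_map proj.

Let proj_eq0 i a : proj i a = 0 <-> a * y i = 0.
Proof.
split=> [/pq_ker/asboolP//|ay]; by apply/pq_ker/asboolP.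
Qed.

Let proj_orth i j : j != i -> proj i (y j) = 0.
Proof. by move=> ji; apply/proj_eq0/y_orth. Qed.

Let proj_neq0 i : proj i (y i) != 0.
Proof.
by apply/eqP => /proj_eq0/eqP; rewrite (negPf (atom_sqr_neq0 i)).
Qed.

Lemma atoms_subdirect : is_subdirect_product f.
Proof.
split=> [a b /ffunP ab|j d].
  apply/eqP; rewrite -subr_eq0; apply/eqP/y_ann => i; apply/proj_eq0.
  by have := ab i; rewrite !ffunE rmorphB => ->; rewrite subrr.
have [a <-] := pq_surj (q j) d; exists a.
by rewrite ffunE.
Qed.

Let conductor := \sum_i y i.

Let proj_conductor i : proj i conductor = proj i (y i).
Proof.
rewrite /conductor (bigD1 i)//= rmorphD rmorph_sum big1 ?addr0// => j ji.
exact: proj_orth.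
Qed.

(** On the i-th component only the multiples of y_i survive, by orthogonality:
    if x_i is the class of r_i, then c x is the image of the sum of the r_i
    y_i. *)
Lemma conductor_product (x : prod_ring (fun i => D i)) :
  exists a, f conductor * x = f a.
Proof.
have /choice[r rE] : forall i, exists a, proj i a = x i.
  by move=> i; apply: pq_surj.
exists (\sum_i r i * y i); apply/ffunP => i.
rewrite !ffunE proj_conductor (bigD1 i)//= rmorphD rmorph_sum big1 => [|j ji].
  by rewrite addr0 rmorphM rE mulrC.
by rewrite rmorphM proj_orth// mulr0.
Qed.

Let frac i :
    {rmorphism prod_ring (fun i => D i : comPzRingType) -> {fraction D i}} :=
  @FracField.tofrac (D i) \o prod_proj (D := fun i => D i) i.
Let iota : {rmorphism prod_ring (fun i => D i : comPzRingType) ->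
    prod_ring (fun i => {fraction (D i)} : comPzRingType)} := prod_map frac.

Lemma prod_fraction_unit (x : prod_ring (fun i => D i)) :
  (forall i, x i != 0) -> is_unit (iota x).
Proof.
move=> x_neq0.
exists [ffun i => (FracField.tofrac (x i))^-1 : {fraction (D i)}].
apply/ffunP => i; rewrite !ffunE /= divff//.
by rewrite tofrac_eq0; apply: x_neq0.
Qed.

Lemma prod_fraction_inj : injective iota.
Proof.
move=> u v /ffunP uv; apply/ffunP => i.
by have /eqP := uv i; rewrite !ffunE /= tofrac_eq => /eqP.
Qed.

Lemma prod_fraction_numden (z : prod_ring (fun i => {fraction (D i)})) :
  exists u v : prod_ring (fun i => D i),
    (forall i, v i != 0) /\ z * iota v = iota u.
Proof.
have H i := fraction_numden (z i).
pose u i := sval (cid (H i)).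
pose v i := sval (cid (svalP (cid (H i)))).
have uvE i : v i != 0 /\ z i * FracField.tofrac (v i) = FracField.tofrac (u i).
  exact: svalP (cid (svalP (cid (H i)))).
exists [ffun i => u i : D i], [ffun i => v i : D i].
split=> [i|]; first by rewrite ffunE; case: (uvE i).
by apply/ffunP => i; rewrite !ffunE /= /prod_proj !ffunE; case: (uvE i).
Qed.

Lemma conductor_neq0 i : f conductor i != 0.
Proof. by rewrite ffunE proj_conductor proj_neq0. Qed.

Lemma atoms_equivalent_orders : equivalent_orders (iota \o f) iota.
Proof.
have c_unit : is_unit (iota (f conductor)).
  exact/prod_fraction_unit/conductor_neq0.
split.
- split=> [a b /prod_fraction_inj/atoms_subdirect.1//|s s_reg|z].
    apply: prod_fraction_unit => i; rewrite ffunE; apply/eqP => /proj_eq0 sy.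
    by move/eqP: (y_atom i).1; apply; apply: s_reg; rewrite sy mulr0.
  have [u [v [v0 zE]]] := prod_fraction_numden z.
  (* z = u / v = (c u) / (c v), with numerator and denominator in A. *)
  have [a aE] := conductor_product u; have [s sE] := conductor_product v.
  exists a, s; split; last first.
    rewrite -[RHS]/(iota (f a)) -[X in z * X]/(iota (f s)) -aE -sE.
    by rewrite !rmorphM mulrCA zE.
  move=> b c bc; apply: atoms_subdirect.1; apply/ffunP => i.
  have := congr1 (fun x => f x i) bc; rewrite !rmorphM -sE !ffunE.
  apply/mulfI/mulf_neq0; last exact: v0.
  by rewrite proj_conductor proj_neq0.
- split=> [|s s_reg|z].
  + exact: prod_fraction_inj.
  + apply: prod_fraction_unit => i; apply/eqP => si0.
    (* The idempotent of the i-th factor is killed by s. *)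
    pose d : prod_ring (fun i => D i) := [ffun j => (j == i)%:R : D j].
    have : d = 0.
      apply: s_reg; rewrite mulr0; apply/ffunP => j; rewrite !ffunE.
      by case: eqP => [->|_]; rewrite ?mulr0// si0 mul0r.
    move=> /ffunP/(_ i); rewrite !ffunE eqxx => /eqP.
    by rewrite oner_eq0.
  + have [u [v [v0 zE]]] := prod_fraction_numden z.
    exists u, v; split=> // b c /ffunP bc; apply/ffunP => i.
    by have := bc i; rewrite !ffunE; apply/mulfI/v0.
- exists 1; split=> [|a]; first by exists 1; rewrite mulr1.
  by exists (f a); rewrite mul1r.
exists (iota (f conductor)); split=> // x.
by have [a aE] := conductor_product x; exists a; rewrite /= -rmorphM aE.
Qed.

End Components.
End Family.
End Atoms.

Theorem theorem5p3 (n : nat) (R : comPzRingType) :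
  reduced R -> n_subperfect n R ->
  goldie R /\
  exists (m : nat) (D : 'I_m -> idomainType)
         (f : {rmorphism R -> prod_ring (fun j => D j)}),
    [/\ is_subdirect_product f,
        forall j, krull_dim (D j) n
      & exists (Q : comPzRingType)
               (iota : {rmorphism prod_ring (fun j => D j) -> Q}),
          equivalent_orders (iota \o f) iota].
Proof.
move=> R_red R_n; have [R_sub _ _ _] := R_n.
have [m [y [y_atom y_orth y_ann]]] :=
  reduced_subperfect_atoms R_red (R_sub [::] (or_introl erefl)).
split; first exact: (atoms_goldie R_red y_atom y_orth y_ann).
have zd i := atom_zero_divisor_prime (y_atom i).
have q_exists i : inhabited (prime_quotient (ann (y i))).
  by apply: prime_quotient_exists; case: (zd i).
pose q i : prime_quotient (ann (y i)) := inhabited_witness (q_exists i).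
exists m, (fun i => pq_dom (q i)), (prod_map (fun i => pq_proj (q i))); split.
- exact: atoms_subdirect.
- move=> i; exact: (krull_dim_quotient (pq_surj (q i)) (pq_ker (q i)) R_n).
- by do 2!eexists; apply: atoms_equivalent_orders.
Qed.
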